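(* Let $S$ be a Polish space with Borel $\sigma$-algebra $\mathscr{B}_S$, and let $\mu_0$ be a diffuse probability measure on $(S,\mathscr{B}_S)$. Let $\boldsymbol{\mu}=\sum_{j\ge1}\mathbf{w}_j\delta_{\boldsymbol{\xi}_j}+\big(1-\sum_{j\ge1}\mathbf{w}_j\big)\mu_0$ be an exchangeable stick-breaking process (ESB) with base measure $\mu_0$, whose exchangeable $[0,1]$-valued length variables $(\mathbf{v}_i)_{i\ge1}$ are directed by the random probability measure $\boldsymbol{\nu}$ on $[0,1]$. Put $\nu_0=\mathbb{E}[\boldsymbol{\nu}]$. (i) If there exists $\varepsilon>0$ such that $(0,\varepsilon)$ is contained in the support of $\nu_0$, then $\boldsymbol{\mu}$ has full support. (ii) $\boldsymbol{\mu}$ is proper if and only if $\boldsymbol{\nu}(\{0\})<1$ almost surely.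
   Context: A species sampling process on a Polish space $S$ with (diffuse) base measure $\mu_0$ is a random probability measure $\boldsymbol{\mu}=\sum_{j\ge1}\mathbf{w}_j\delta_{\boldsymbol{\xi}_j}+(1-\sum_{j\ge1}\mathbf{w}_j)\mu_0$, where $(\mathbf{w}_j)_{j\ge1}$ are non-negative random variables with $\sum_j\mathbf{w}_j\le1$ a.s., independent of the atoms $(\boldsymbol{\xi}_j)_{j\ge1}$, which are i.i.d. with law $\mu_0$. It is proper if $\sum_j\mathbf{w}_j=1$ a.s. An ESB is a species sampling process whose weights are given by stick-breaking, $\mathbf{w}_1=\mathbf{v}_1$, $\mathbf{w}_j=\mathbf{v}_j\prod_{i=1}^{j-1}(1-\mathbf{v}_i)$ for $j\ge2$, where $(\mathbf{v}_i)_{i\ge1}$ is an exchangeable sequence of $[0,1]$-valued random variables (independent of the atoms); by de Finetti's theorem the $\mathbf{v}_i$ are conditionally i.i.d. given a random probability measure $\boldsymbol{\nu}$ on $[0,1]$ (the directing measure). ''Full support'' means: the topological support, with respect to the weak topology on the space of probability measures, of the law of $\boldsymbol{\mu}$ is the set of all probability measures whose support is contained in the support of $\mu_0$ (in particular, all probability measures on $S$ when $\mu_0$ has support $S$). *)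

(* Defs.v *)
From HB Require Import structures.
From mathcomp Require Import all_boot all_order all_algebra.
From mathcomp Require Import all_classical all_reals all_analysis measurable_realfun.
Set Implicit Arguments. Unset Strict Implicit. Unset Printing Implicit Defensive.
Import Order.TTheory GRing.Theory Num.Theory.
Import numFieldNormedType.Exports.
Local Open Scope classical_set_scope.
Local Open Scope ring_scope.

(* Polish space: separable (countable dense subset), metrizable by a complete
   metric; we take S equipped with a complete (pseudo)metric and require it to be
   Hausdorff (so the pseudometric is a metric). *)
Definition polish {R : realType} (S : completePseudoMetricType R) :=
  hausdorff_space S /\ exists D : set S, countable D /\ dense D.

Definition borel (S : ptopologicalType) : measurableType (sigma_display (@open S)) := g_sigma_algebraType (@open S).

Definition msupp {R : realType} {T : topologicalType} (m : set T -> \bar R) :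
  set T := [set x | forall U : set T, open U -> U x -> (0 < m U)%E].

Definition stick_weight {R : realType} {Omega : Type} (v : nat -> Omega -> R)
  (j : nat) (w : Omega) : R := v j w * \prod_(i < j) (1 - v i w).

Definition gen_by_random_measure {R : realType} {d} {Omega : measurableType d}
  (nu : Omega -> set R -> \bar R) : set (set Omega) :=
  [set E | exists (B : set R) (A : set \bar R),
      measurable B /\ @measurable _ (\bar R) A /\ E = (fun w => nu w B) @^-1` A].

(* The lengths v are conditionally i.i.d. given nu, with common conditional law
   nu: for all n, Borel B_0..B_{n-1} and G in sigma(nu),
   P(G /\ v_i in B_i for i<n) = E[1_G prod_i nu(B_i)]. *)
Definition directed_by {R : realType} {d} {Omega : measurableType d}
  (P : probability Omega R) (v : nat -> Omega -> R)
  (nu : Omega -> set R -> \bar R) : Prop :=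
  forall (n : nat) (B : 'I_n -> set R), (forall i, measurable (B i)) ->
  forall G : set Omega, <<s gen_by_random_measure nu >> G ->
    P (G `&` [set w | forall i : 'I_n, B i (v i w)]) =
    (\int[P]_(w in G) \prod_(i < n) nu w (B i))%E.

(* Membership of pi in the topological support (weak topology on probability
   measures on S, i.e. the topology generated by rho |-> int f d rho for f bounded
   continuous) of the law of the random probability measure mu:
   every basic weak neighbourhood of pi has positive probability (is not
   P-negligible). *)
Definition in_law_support {R : realType} {d} {Omega : measurableType d}
  (P : probability Omega R) {S : ptopologicalType}
  (mu : Omega -> probability (borel S) R) (pi : probability (borel S) R) : Prop :=
  forall (n : nat) (f : 'I_n -> S -> R) (e : R),
    (forall i, continuous (f i) /\ exists M : R, forall x, `|f i x| <= M) ->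
    0 < e ->
    ~ P.-negligible [set w | forall i : 'I_n,
        (`| \int[mu w]_x (f i x)%:E - \int[pi]_x (f i x)%:E | < e%:E)%E].

(* Main.v *)
(** (i) For small x in (0, eps), all of v_1, ..., v_m lie near x with probability
    E[nu(U)^m] > 0, so the weights are close to the deterministic x (1 - x)^(j-1),
    whose squares sum to at most x. Given pi supported in supp mu0 and test
    functions h_i with zero pi-integral, choose the locations s_j in supp pi greedily,
    each making a nonpositive inner product with the running error vector
    e = sum_j w_j h(s_j); then |e|^2 <= C sum_j w_j^2 <= C x. With positive
    probability the atoms xi_1, ..., xi_m fall near s_1, ..., s_m, and the mass
    prod_(j <= m) (1 - v_j) not yet assigned is negligible.
    Conversely an open mu0-null set is a.s. mu-null, and a function separating a
    point of supp pi from its complement excludes pi from the support.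
    (ii) On {nu [0, delta] <= c} with c < 1, eventually v_i <= delta has probability
    at most lim_m c^m = 0, so a.s. infinitely many v_i exceed some delta > 0 and
    prod_i (1 - v_i) = 0. On {nu {0} = 1} every v_i vanishes a.s. *)

Require Import Defs.
From HB Require Import structures.
From mathcomp Require Import all_boot all_order all_algebra.
From mathcomp Require Import all_classical all_reals all_analysis measurable_realfun.
From mathcomp Require Import ring lra.
Set Implicit Arguments.
Unset Strict Implicit.
Unset Printing Implicit Defensive.
Import Order.TTheory GRing.Theory Num.Theory.
Import numFieldNormedType.Exports.
Local Open Scope classical_set_scope.
Local Open Scope ring_scope.

(** * Stick-breaking weights *)

(** Factors are exchanged one at a time: each exchange costs at most [eta], since the other factors
    lie in [0,1]. *)
Lemma dist_prod_le (R : realType) (a b : nat -> R) (eta : R) (n : nat) :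
  (forall i, 0 <= a i <= 1) -> (forall i, 0 <= b i <= 1) ->
  (forall i, (i < n)%N -> `|a i - b i| <= eta) ->
  `|\prod_(i < n) a i - \prod_(i < n) b i| <= n%:R * eta.
Proof.
move=> a01 b01; elim: n => [|n IH] ab.
  by rewrite !big_ord0 subrr normr0 mul0r.
rewrite !big_ord_recr/=.
have -> : \prod_(i < n) a i * a n - \prod_(i < n) b i * b n =
  (\prod_(i < n) a i - \prod_(i < n) b i) * a n +
  \prod_(i < n) b i * (a n - b n) by ring.
have -> : n.+1%:R * eta = n%:R * eta + eta by rewrite -natr1 mulrDl mul1r.
rewrite (le_trans (ler_normD _ _))// lerD//.
- rewrite normrM; have /andP[an0 an1] := a01 n.
  rewrite (ger0_norm an0) (le_trans (ler_piMr _ an1))// IH// => i /ltnW; exact: ab.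
- rewrite normrM ger0_norm ?prodr_ge0// => [|i _]; last by case/andP: (b01 i).
  rewrite (le_trans (ler_piMl _ _))// ?ab//.
  by apply: prodr_ile1 => i _.
Qed.

Section sticks.
Context {R : realType} {Omega : Type} (v : nat -> Omega -> R).
Hypothesis v01 : forall i w, 0 <= v i w <= 1.

Lemma onem_v01 i w : 0 <= 1 - v i w <= 1.
Proof. by have := v01 i w; lra. Qed.

Lemma remainder01 n w : 0 <= \prod_(i < n) (1 - v i w) <= 1.
Proof.
rewrite prodr_ge0 ?prodr_ile1// => i _; first exact: onem_v01.
by case/andP: (onem_v01 i w).
Qed.

Lemma stick_weight_ge0 j w : 0 <= stick_weight v j w.
Proof.
rewrite /stick_weight mulr_ge0//; first by case/andP: (v01 j w).
by case/andP: (remainder01 j w).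
Qed.

(** Breaking off a piece shortens the remaining stick by the length of that piece, so partial sums
    of weights telescope. *)
Lemma stick_weightE j w : stick_weight v j w =
  \prod_(i < j) (1 - v i w) - \prod_(i < j.+1) (1 - v i w).
Proof. by rewrite /stick_weight big_ord_recr/=; ring. Qed.

Lemma stick_sum n w :
  \sum_(j < n) stick_weight v j w = 1 - \prod_(i < n) (1 - v i w).
Proof.
elim: n => [|n IH]; first by rewrite !big_ord0 subrr.
by rewrite big_ord_recr/= IH stick_weightE; ring.
Qed.

Lemma stick_series_ge n w :
  ((\sum_(j < n) stick_weight v j w)%:E <=
   \sum_(j <oo) (stick_weight v j w)%:E)%E.
Proof.
rewrite -sumEFin -(big_mkord xpredT (fun j => (stick_weight v j w)%:E)).
by apply: nneseries_lim_ge => k _; rewrite lee_fin stick_weight_ge0.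
Qed.

Lemma stick_series_le1 w : (\sum_(j <oo) (stick_weight v j w)%:E <= 1)%E.
Proof.
apply: lime_le.
  by apply: is_cvg_nneseries => k _ _; rewrite lee_fin stick_weight_ge0.
apply: nearW => n; rewrite big_mkord sumEFin lee_fin stick_sum.
by have := remainder01 n w; lra.
Qed.

(** A weight is a difference of two remainders, each perturbed by at most [n%:R * eta]. The
    deterministic sequence [u] is treated as a process on the one-point space [unit]. *)
Lemma stick_weight_dist (u : nat -> R) (eta : R) n j w :
  (forall i, 0 <= u i <= 1) -> (forall i, (i < n)%N -> `|v i w - u i| <= eta) ->
  (j < n)%N -> 0 <= eta ->
  `|stick_weight v j w - stick_weight (fun i (_ : unit) => u i) j tt|
    <= 2 * n%:R * eta.
Proof.
move=> u01 vu jn eta0.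
have D k : (k <= n)%N ->
    `|\prod_(i < k) (1 - v i w) - \prod_(i < k) (1 - u i)| <= n%:R * eta.
  move=> kn; have := @dist_prod_le R (fun i => 1 - v i w) (fun i => 1 - u i) eta k.
  move=> /(_ (onem_v01^~ w)) H; apply: le_trans (H _ _) _.
  - by move=> i; have := u01 i; lra.
  - move=> i ik; rewrite opprB addrCA addrAC subrr add0r distrC.
    exact/vu/(leq_trans ik).
  - by rewrite ler_wpM2r// ler_nat.
rewrite stick_weightE (_ : stick_weight (fun i _ => u i) j tt =
  \prod_(i < j) (1 - u i) - \prod_(i < j.+1) (1 - u i)); last first.
  by rewrite /stick_weight big_ord_recr/=; ring.
have := D _ (ltnW jn); have := D _ jn; rewrite !ler_norml; lra.
Qed.

End sticks.

(** * Borel probability measures and their supports *)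

Lemma open_borel (S : ptopologicalType) (U : set S) :
  open U -> measurable (U : set (borel S)).
Proof. exact: sub_sigma_algebra. Qed.

Lemma continuous_borel (R : realType) (S : ptopologicalType) (f : S -> R) :
  continuous f -> measurable_fun setT (f : borel S -> R).
Proof.
move=> /continuousP cf.
apply: (measurability (RGenOInfty.G (R := R))).
  exact: RGenOInfty.measurableE.
move=> _ [_ [x ->] <-]; rewrite setTI.
by apply: open_borel; apply: cf; rewrite set_itvoy; exact: open_gt.
Qed.

Lemma bounded_continuous_integrable (R : realType) (S : ptopologicalType)
    (m : probability (borel S) R) (f : S -> R) (M : R) :
  continuous f -> (forall x, `|f x| <= M) ->
  m.-integrable setT (EFin \o (f : borel S -> R)).
Proof.
move=> cf fM; apply: measurable_bounded_integrable => //.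
- by rewrite (le_lt_trans (probability_le1 m measurableT))// ltry.
- exact: continuous_borel.
- exists M; split; [exact: num_real|move=> N MN x _].
  by apply: le_trans (fM x) _; exact: ltW.
Qed.

(** By separability, countably many null balls, centred in a dense set and of radii 1/(k+1), cover
    the complement of the support. *)
Lemma msupp_negligibleC (R : realType) (S : completePseudoMetricType R)
    (m : probability (borel S) R) :
  polish S -> m.-negligible (~` msupp m : set (borel S)).
Proof.
move=> [_ [D [cD dD]]].
have /countable_injP[h hinj] := cD.
(* [g] enumerates [D] by inverting the injection [h]; indices outside the range give the default
   [point], harmless because [C] keeps null balls only. *)
pose g n := xget point [set s | D s /\ h s = n].
have gh s : D s -> g (h s) = s.
  move=> Ds; have [Dg hg] : D (g (h s)) /\ h (g (h s)) = h s.
    by apply: (xgetPex point (P := [set t | D t /\ h t = h s])); exists s.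
  by apply: hinj; rewrite ?inE.
pose B n k : set S := (ball (g n) k.+1%:R^-1)°.
pose C n k := if m (B n k) == 0%E then B n k else set0.
apply: (@negligibleS _ _ _ _ (\bigcup_n \bigcup_k (C n k : set (borel S)))); last first.
  do 2 (apply: negligible_bigcup => ?); rewrite /C; case: ifPn => [/eqP B0|_].
    by apply/negligibleP => //; apply: open_borel; exact: open_interior.
  exact: negligible_set0.
move=> x /= /existsNP[U /not_implyP[oU /not_implyP[Ux /negP]]].
rewrite -leNgt => mU; have [e e0 eU] : exists2 e : R, 0 < e & ball x e `<=` U.
  by have /nbhs_ballP[e e0 eU] := open_nbhs_nbhs (conj oU Ux); exists e.
have [k ke] : exists k : nat, k.+1%:R^-1 < e / 2.
  exists (Num.truncn (e / 2)^-1); rewrite invf_plt ?posrE ?divr_gt0//.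
  exact: truncnS_gt.
(* With the centre [y] within half a radius of [x], the ball about [y] has [x] in its interior and
   still lies inside [U]. *)
have k0 : 0 < k.+1%:R^-1 / 2 :> R by rewrite divr_gt0// invr_gt0.
have [y [yx Dy]] : ((ball x (k.+1%:R^-1 / 2))° `&` D) !=set0.
  apply: dD; last exact: open_interior.
  by exists x; exact: nbhsx_ballx.
exists (h y) => //; exists k => //; rewrite /C /B gh//.
have xB : (ball y k.+1%:R^-1)° x.
  rewrite /interior; apply/nbhs_ballP; exists (k.+1%:R^-1 / 2) => //= z xz.
  by apply: (ball_split (z := x)) => //; apply: ball_sym; exact: interior_subset.
case: ifPn => // /eqP[]; apply/eqP; rewrite -measure_le0 (le_trans _ mU)//.
apply: le_measure; rewrite ?inE; [apply: open_borel; exact: open_interior|exact: open_borel|].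
move=> z /interior_subset yz; apply: eU; rewrite (splitr e).
apply: (ball_triangle (y := y)); apply: le_ball (_ : ball _ k.+1%:R^-1 _) => //.
- exact: ltW.
- by apply: le_ball (interior_subset yx); rewrite ler_pdivrMr// ler_peMr// ler1n.
- exact: ltW.
Qed.

(** Otherwise [f] is positive almost everywhere, while a zero integral then forces [f] to vanish
    almost everywhere: impossible for total mass 1. *)
Lemma msupp_le0 (R : realType) (S : completePseudoMetricType R)
    (m : probability (borel S) R) (f : S -> R) (M : R) :
  polish S -> continuous f -> (forall x, `|f x| <= M) ->
  (\int[m]_x (f x)%:E = 0)%E -> exists2 x, msupp m x & f x <= 0.
Proof.
move=> pS cf fM f0; apply: contrapT => nex.
have fpos x : msupp m x -> 0 < f x.
  by move=> mx; rewrite ltNge; apply/negP => fx; apply: nex; exists x.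
have sf : {ae m, forall x, 0 < f x}.
  apply: negligibleS (msupp_negligibleC m pS) => x /= fx mx; exact/fx/fpos.
have mf := continuous_borel cf.
have mE : measurable_fun setT (EFin \o (f : borel S -> R)) by exact/measurable_EFinP.
have : (\int[m]_x `|(f x)%:E| = 0)%E.
  rewrite -f0; apply: ae_eq_integral => //; first exact: measurableT_comp.
  by apply: negligibleS sf => x /= nfx fx; apply: nfx => _; rewrite ger0_norm// ltW.
move/(ae_eq_integral_abs m measurableT mE) => ae0.
have : m.-negligible [set: borel S].
  apply: negligibleS (negligibleU sf ae0) => x _ /=.
  by apply/not_andP => -[fx] /(_ I) [fx0]; rewrite fx0 ltxx in fx.
move/(measure_negligible measurableT) => m0.
have /eqP := etrans (esym (probability_setT m)) m0.
by rewrite onee_eq0.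
Qed.

(** * Atomic approximation *)

Lemma continuous_lincomb (R : realType) (S : topologicalType) (I : Type)
    (r : seq I) (c : I -> R) (h : I -> S -> R) :
  (forall i, continuous (h i)) -> continuous (fun x => \sum_(i <- r) c i * h i x).
Proof.
move=> ch; elim: r => [|i r IH] x.
  by under eq_fun do rewrite big_nil; exact: cvg_cst.
under eq_fun do rewrite big_cons.
apply: (@continuousD _ _ _ (fun x => c i * h i x)); last exact: IH.
by apply: continuousM; [exact: cst_continuous|exact: ch].
Qed.

(** The combination again has integral zero. This supplies the greedy choice with a point of the
    support for every error vector [c]. *)
Lemma msupp_lincomb_le0 (R : realType) (S : completePseudoMetricType R)
    (m : probability (borel S) R) (n : nat) (h : 'I_n -> S -> R) (K : R)
    (c : 'I_n -> R) :
  polish S -> (forall i, continuous (h i)) -> (forall i x, `|h i x| <= K) ->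
  (forall i, \int[m]_x (h i x)%:E = 0)%E ->
  exists2 x, msupp m x & \sum_i c i * h i x <= 0.
Proof.
move=> pS ch hK h0.
apply: (@msupp_le0 _ _ m _ (\sum_i `|c i| * K)) => //.
- exact: continuous_lincomb.
- move=> x; rewrite (le_trans (ler_norm_sum _ _ _))// ler_sum// => i _.
  by rewrite normrM ler_wpM2l.
under eq_integral do rewrite -sumEFin.
have ih i : m.-integrable setT (EFin \o (h i : borel S -> R)).
  exact: bounded_continuous_integrable (ch i) (hK i).
rewrite integral_sum//.
  rewrite big1// => i _; transitivity ((c i)%:E * \int[m]_x (h i x)%:E)%E.
    by rewrite -integralZl//; exact: ih.
  by rewrite h0 mule0.
by move=> i; exact: (integrableZl measurableT (c i) (ih i)).
Qed.

(** The setwise bound says that [m] dominates the measure with masses [a j] at [s j]; domination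
    passes to integrals of nonnegative functions. *)
Lemma le_integral_atoms (R : realType) (d : measure_display)
    (T : measurableType d) (m : {measure set T -> \bar R}) (n : nat)
    (a : nat -> R) (s : nat -> T) (g : T -> R) :
  (forall j, 0 <= a j) ->
  (forall A, measurable A ->
    (\sum_(j < n) (a j)%:E * (\1_A (s j))%:E <= m A)%E) ->
  measurable_fun setT g -> (forall x, 0 <= g x) ->
  ((\sum_(j < n) a j * g (s j))%:E <= \int[m]_x (g x)%:E)%E.
Proof.
move=> a0 am mg g0.
pose k j : {measure set T -> \bar R} := mscale (NngNum (a0 j)) \d_(s j).
have mE : measurable_fun setT (EFin \o g) by exact/measurable_EFinP.
have := @ge0_le_measure_integral _ _ _ (msum k n) m _ (EFin \o g) setT measurableT.
rewrite ge0_integral_measure_sum//; last by move=> x _; rewrite lee_fin.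
rewrite -sumEFin => H; apply: le_trans (H _ _ _) => //.
  apply: lee_sum => j _; rewrite ge0_integral_mscale//=; last first.
    by move=> x _; rewrite lee_fin.
  rewrite integral_dirac//.
  by rewrite diracT mul1e.
Qed.

(** Beyond the atoms, [m] has mass [1 - \sum_(j < n) a j], on which [g] is bounded by [K]. *)
Lemma dist_integral_atoms (R : realType) (d : measure_display)
    (T : measurableType d) (m : probability T R) (n : nat)
    (a : nat -> R) (s : nat -> T) (g : T -> R) (K : R) :
  (forall j, 0 <= a j) ->
  (forall A, measurable A ->
    (\sum_(j < n) (a j)%:E * (\1_A (s j))%:E <= m A)%E) ->
  measurable_fun setT g -> (forall x, `|g x| <= K) ->
  (`|\int[m]_x (g x)%:E - (\sum_(j < n) a j * g (s j))%:E| <=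
    (K * (1 - \sum_(j < n) a j))%:E)%E.
Proof.
move=> a0 am mg gK.
have ig : m.-integrable setT (EFin \o g).
  apply: measurable_bounded_integrable => //.
    by rewrite (le_lt_trans (probability_le1 m measurableT))// ltry.
  exists K; split; [exact: num_real|move=> N KN x _].
  by apply: le_trans (gK x) _; exact: ltW.
have iK : m.-integrable setT (EFin \o cst K) by exact: finite_measure_integrable_cst.
have /fineK <- := integrable_fin_num measurableT ig.
set I := fine _.
have IE : (\int[m]_x (g x)%:E = I%:E)%E by rewrite /I fineK// integrable_fin_num.
have KE : (\int[m]_x K%:E = K%:E)%E.
  have := integral_cst m measurableT K%:E => /= ->.
  by have -> := probability_setT m; rewrite mule1.
(* Domination applied to the nonnegative functions [K + g] and [K - g] gives the two one-sided
   bounds without subtracting measures. *)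
have Kp x : 0 <= K + g x by have := gK x; rewrite ler_norml; lra.
have Km x : 0 <= K - g x by have := gK x; rewrite ler_norml; lra.
have := le_integral_atoms a0 am (measurable_funD (measurable_cst K) mg) Kp.
have := le_integral_atoms a0 am (measurable_funB (measurable_cst K) mg) Km.
under eq_integral do rewrite EFinB.
rewrite integralB_EFin// KE IE -EFinB lee_fin => HB.
under eq_integral do rewrite EFinD.
rewrite integralD_EFin// KE IE -EFinD lee_fin => HD.
move: HB HD.
under eq_bigr do rewrite mulrBr.
under [X in _ -> X <= _ -> _]eq_bigr do rewrite mulrDr.
rewrite sumrB big_split/= -mulr_suml => HB HD.
by rewrite lee_fin ler_norml; lra.
Qed.

(* The cross term of each squared-norm increment is nonpositive by the choice of
   the next point, so only the diagonal terms [a j ^+ 2] accumulate. *)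
Lemma greedy_balancing (R : realType) (S : Type) (D : set S) (n : nat)
    (h : 'I_n -> S -> R) (K : R) (a : nat -> R) :
  (forall j, 0 <= a j) ->
  (forall i x, `|h i x| <= K) ->
  (forall c : 'I_n -> R, exists2 x, D x & \sum_i c i * h i x <= 0) ->
  exists2 s : nat -> S, forall j, D (s j) &
    forall m, \sum_i (\sum_(j < m) a j * h i (s j)) ^+ 2 <=
      n%:R * K ^+ 2 * \sum_(j < m) a j ^+ 2.
Proof.
move=> a0 hK hD.
have /choice[pk pkP] (c : 'I_n -> R) :
    exists x, D x /\ \sum_i c i * h i x <= 0.
  by have [x Dx hx] := hD c; exists x.
(* [err j] is the error vector after [j] points; the next point is the one picked against it by
   [pk]. *)
pose err := fix err j i := if j is k.+1
  then err k i + a k * h i (pk (err k)) else 0.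
exists (fun j => pk (err j)) => [j|m]; first exact: (pkP (err j)).1.
have errE i : \sum_(j < m) a j * h i (pk (err j)) = err m i.
  elim: m => [|m IH]; first by rewrite big_ord0.
  by rewrite big_ord_recr/= IH.
under eq_bigr do rewrite errE.
elim: m {errE} => [|m IH].
  by rewrite big_ord0 mulr0 big1// => i _; rewrite expr0n.
rewrite big_ord_recr/= mulrDr.
set x := pk (err m).
have -> : \sum_i (err m i + a m * h i x) ^+ 2 =
    \sum_i err m i ^+ 2 + a m *+ 2 * \sum_i err m i * h i x +
    \sum_i (a m * h i x) ^+ 2.
  rewrite mulr_sumr -!big_split/=; apply: eq_bigr => i _.
  by rewrite sqrrD; ring.
rewrite -addrA lerD// (_ : _ * a m ^+ 2 = 0 + \sum_(i < n) (a m * K) ^+ 2).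
  apply: lerD.
    by rewrite mulr_ge0_le0 ?mulrn_wge0//; exact: (pkP (err m)).2.
  apply: ler_sum => i _; rewrite !exprMn ler_wpM2l ?sqr_ge0//.
  by rewrite -[_ ^+ 2]real_normK ?num_real// lerXn2r ?nnegrE// (le_trans _ (hK i x)).
by rewrite add0r sumr_const card_ord -mulr_natl exprMn; ring.
Qed.

(** * Length variables directed by a random measure *)

Lemma exists_exp_lt (R : realType) (c e : R) :
  0 <= c < 1 -> 0 < e -> exists m, c ^+ m < e.
Proof.
move=> /andP[c0 c1] e0.
have /cvgr0_norm_lt/(_ e e0)[m _ /(_ m (leqnn m))] : (fun m => c ^+ m) @ \oo --> 0.
  have cl : `|c| < 1 by rewrite ger0_norm.
  exact: (cvg_expr cl).
by rewrite /= ger0_norm ?exprn_ge0//; exists m.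
Qed.

Lemma prode_const_fine (R : realType) (x : \bar R) n :
  x \is a fin_num -> (\prod_(i < n) x = (fine x ^+ n)%:E)%E.
Proof.
move=> /fineK {1}<-; elim: n => [|n IH]; first by rewrite big_ord0 expr0.
by rewrite big_ord_recr/= IH -EFinM exprSr.
Qed.

(** The remaining stick never grows, and each length above [delta] shrinks it by a factor at most
    [1 - delta]; hence it tends to 0. *)
Lemma stick_series_eq1 (R : realType) (Omega : Type) (v : nat -> Omega -> R)
    (w : Omega) (delta : R) :
  (forall i w, 0 <= v i w <= 1) -> 0 < delta ->
  (forall N, exists2 i, (N <= i)%N & delta < v i w) ->
  (\sum_(j <oo) (stick_weight v j w)%:E = 1)%E.
Proof.
move=> v01 d0 vd.
pose r n := \prod_(i < n) (1 - v i w).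
have d1 : delta <= 1.
  by have [i _ /ltW dv] := vd 0%N; apply: le_trans dv _; case/andP: (v01 i w).
have rn n k : r (n + k)%N <= r n.
  elim: k => [|k IH]; first by rewrite addn0.
  rewrite addnS /r big_ord_recr/= -/(r _) (le_trans _ IH)// ler_piMr//.
    by case/andP: (remainder01 v01 (n + k) w).
  by case/andP: (onem_v01 v01 (n + k) w).
have r_le j : exists n, r n <= (1 - delta) ^+ j.
  elim: j => [|j [n IH]]; first by exists 0%N; rewrite /r big_ord0 expr0.
  have [i ni vi] := vd n; exists i.+1.
  rewrite /r big_ord_recr/= exprSr -/(r i) ler_pM//.
  - by case/andP: (remainder01 v01 i w).
  - by case/andP: (onem_v01 v01 i w).
  - by apply: le_trans IH; rewrite -(subnKC ni).
  - by lra.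
apply/eqP; rewrite eq_le stick_series_le1//=.
apply/lee_addgt0Pr => e e0.
have [j je] := @exists_exp_lt R (1 - delta) e ltac:(lra) e0.
have [n rj] := r_le j.
apply: le_trans (leeD (stick_series_ge v01 n w) (lexx e%:E)).
rewrite -EFinD lee_fin stick_sum -/(r n); lra.
Qed.

Section directed.
Context {R : realType} {d : measure_display} {Omega : measurableType d}.
Context (P : probability Omega R) (v : nat -> Omega -> R).
Context (nu : Omega -> probability R R).
Hypothesis mv : forall i, measurable_fun setT (v i).
Hypothesis v01 : forall i w, 0 <= v i w <= 1.
Hypothesis mnu : forall B : set R, measurable B ->
  measurable_fun setT (fun w => nu w B).
Hypothesis vnu : directed_by P v (fun w => nu w).

Lemma nu_fin_num w (B : set R) : measurable B -> nu w B \is a fin_num.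
Proof. by move=> mB; exact: fin_num_measure. Qed.

Lemma measurable_v_in i (B : set R) :
  measurable B -> measurable [set w | B (v i w)].
Proof. by move=> mB; rewrite -[X in measurable X]setTI; exact: mv. Qed.

Lemma gen_nu_preimage (B : set R) (A : set \bar R) :
  measurable B -> measurable A ->
  <<s gen_by_random_measure (fun w => nu w) >> [set w | A (nu w B)].
Proof. by move=> mB mA; apply: sub_sigma_algebra; exists B, A. Qed.

Lemma measurable_nu_preimage (B : set R) (A : set \bar R) :
  measurable B -> measurable A -> measurable [set w | A (nu w B)].
Proof. by move=> mB mA; have := mnu mB measurableT mA; rewrite setTI. Qed.

Lemma measurable_fine_nu (B : set R) : measurable B ->
  measurable_fun setT (fun w => fine (nu w B)).
Proof. by move=> mB; apply: measurableT_comp (mnu mB); exact: fine_measurable. Qed.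

Lemma directed_cst (B : set R) (N m : nat) (G : set Omega) : measurable B ->
  <<s gen_by_random_measure (fun w => nu w) >> G ->
  P (G `&` [set w | forall i : 'I_(N + m), (N <= i)%N -> B (v i w)]) =
  (\int[P]_(w in G) (fine (nu w B) ^+ m)%:E)%E.
Proof.
(* The first [N] lengths are left free and contribute factors 1. *)
move=> mB sG; pose B' (i : 'I_(N + m)) := if (i < N)%N then setT else B.
have mB' i : measurable (B' i) by rewrite /B'; case: ifP.
rewrite (_ : [set w | _] = [set w | forall i, B' i (v i w)]); last first.
  apply/seteqP; split => w /= H i; have := H i; rewrite /B'.
    by case: ltnP => // _; apply.
  by case: ltnP.
rewrite vnu//; apply: eq_integral => w _.
rewrite big_split_ord/= big1 ?mul1e => [|i _]; last first.
  by rewrite /B' /= ltn_ord; exact: probability_setT.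
rewrite (eq_bigr (fun=> nu w B)) => [|i _]; last first.
  by rewrite /B'/= ltnNge leq_addr.
by rewrite prode_const_fine// nu_fin_num.
Qed.

(** Where [nu w B <= c], having [m] consecutive lengths in [B] from index [N] on has probability at
    most [c ^+ m], for every [m]. *)
Lemma tail_in_null (B : set R) (c : R) (N : nat) : measurable B -> 0 <= c < 1 ->
  P.-negligible [set w | (nu w B <= c%:E)%E /\
                         forall i, (N <= i)%N -> B (v i w)].
Proof.
move=> mB c01; pose G := [set w | (nu w B <= c%:E)%E].
have mc : measurable [set x | (x <= c%:E)%E].
  by rewrite -set_itvNyc; exact: emeasurable_itv.
have mG : measurable G by exact: (measurable_nu_preimage mB mc).
have mA : measurable (G `&` \bigcap_(i in [set i | (N <= i)%N]) [set w | B (v i w)]).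
  apply: measurableI => //; apply: bigcap_measurable; first by exists N => /=.
  by move=> i _; exact: measurable_v_in.
apply: (@negligibleS _ _ _ _ (G `&` \bigcap_(i in [set i | (N <= i)%N]) [set w | B (v i w)])).
  by move=> w [Gw Bw]; split => // i /= Ni; exact: Bw.
apply/negligibleP => //; apply/eqP; rewrite -measure_le0 leNgt; apply/negP => PA0.
have PAfin := fin_num_measure P _ mA.
have [m] := @exists_exp_lt R c (fine (P (G `&` \bigcap_(i in [set i | (N <= i)%N])
  [set w | B (v i w)]))) c01 ltac:(by rewrite fine_gt0// PA0 ltey_eq PAfin).
rewrite ltNge => /negP; apply; rewrite -lee_fin fineK//.
apply: (@le_trans _ _ (P (G `&`
    [set w | forall i : 'I_(N + m), (N <= i)%N -> B (v i w)]))).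
  apply: le_measure; rewrite ?inE//; last first.
    by move=> w [Gw Bw]; split => // i; exact: Bw.
  apply: measurableI => //.
  rewrite (_ : [set _ | _] = \bigcap_(i < N + m)
      [set w | (N <= i)%N -> B (v i w)]).
    apply: bigcap_measurableType => // i _; have [Ni|Ni] := leqP N i.
      rewrite (_ : [set w | _] = [set w | B (v i w)]); first exact: measurable_v_in.
      by apply/seteqP; split => w //=; apply.
    by rewrite (_ : [set w | _] = setT)//; apply/seteqP; split.
  apply/seteqP; split => w /= H i => [iNm|]; last exact: (H i (ltn_ord i)).
  exact: (H (Ordinal iNm)).
rewrite directed_cst//; last exact: (gen_nu_preimage mB mc).
apply: (@le_trans _ _ (\int[P]_(w in G) (c ^+ m)%:E)%E).
  apply: ge0_le_integral => //.
  - by move=> w _; rewrite lee_fin exprn_ge0// fine_ge0.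
  - apply/measurable_EFinP/measurable_funX.
    exact: measurable_funS (measurable_fine_nu mB).
  - move=> w Gw; rewrite lee_fin lerXn2r ?nnegrE ?fine_ge0//.
      by case/andP: c01.
    by rewrite -lee_fin fineK// nu_fin_num.
rewrite integral_cst// -[leRHS]mule1 lee_wpmul2l//.
  by rewrite lee_fin exprn_ge0//; case/andP: c01.
exact: probability_le1.
Qed.

(** The masses of [0, 1/(k+1)] decrease to that of {0}, so some such interval has mass at most 1 -
    1/(l+1). The exceptional set is a countable union over [k], [l], [N] of null tail events. *)
Lemma ae_infinitely_often_large :
  {ae P, forall w, (nu w [set 0%R] < 1)%E} ->
  {ae P, forall w, exists2 delta : R, 0 < delta &
    forall N, exists2 i, (N <= i)%N & delta < v i w}.
Proof.
move=> nu0; pose B k := [set x : R | 0 <= x <= k.+1%:R^-1].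
have mB k : measurable (B k).
  have -> : B k = `[0, k.+1%:R^-1]%classic.
    by apply/seteqP; split => x /=; rewrite in_itv.
  exact: measurable_itv.
have BI : \bigcap_k B k = [set 0].
  apply/seteqP; split => [x Bx|x /= -> k _]; last first.
    by rewrite /B /= lexx invr_ge0 ler0n.
  apply/eqP; rewrite eq_le; have /andP[-> _] := Bx 0%N I; rewrite andbT.
  apply/ler_addgt0Pr => e e0; rewrite add0r.
  have /andP[_ /le_trans] := Bx (Num.truncn e^-1) I; apply.
  by rewrite invf_ple ?posrE// ltW// truncnS_gt.
apply: negligibleS (negligibleU nu0 (negligible_bigcup (fun k =>
  negligible_bigcup (fun l => negligible_bigcup (fun N =>
  @tail_in_null (B k) (1 - l.+1%:R^-1) N (mB k) _))))); last first.
  move=> k l; rewrite subr_ge0 invf_le1 ?ler1n//= ltrBlDr ltrDl invr_gt0//.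
move=> w /= small; have [nu0w|] := pselect (nu w [set 0%R] < 1)%E; last by left.
right; have [k Bk] : exists k, (nu w (B k) < 1)%E.
  apply: contrapT => /forallNP Bk; move: nu0w; apply/negP; rewrite -leNgt -BI.
  have cB : nu w \o B @ \oo --> nu w (\bigcap_n B n).
    apply: nonincreasing_cvg_mu => //.
    - by rewrite (le_lt_trans (probability_le1 (nu w) (mB _)))// ltry.
    - exact: bigcapT_measurable.
    - move=> m n mn; apply/subsetPset => x /andP[x0 xn]; rewrite /B /= x0.
      by rewrite (le_trans xn)// lef_pV2 ?posrE// ler_nat.
  rewrite -(cvg_lim _ cB)//; apply: lime_ge; first by apply/cvg_ex; eexists; exact: cB.
  by apply: nearW => n; rewrite leNgt; apply/negP; exact: Bk.
have Bkfin := nu_fin_num w (mB k).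
move: Bk; rewrite -(fineK Bkfin) lte_fin -subr_gt0 => q0.
have [N vN] : exists N, forall i, (N <= i)%N -> v i w <= k.+1%:R^-1.
  apply: contrapT => /forallNP vN; apply: small; exists k.+1%:R^-1.
    by rewrite invr_gt0.
  move=> N; have /existsNP[i /not_implyP[Ni /negP]] := vN N.
  by rewrite -ltNge; exists i.
(* This [l] satisfies 1/(l+1) <= 1 - [nu w (B k)]. *)
exists k => //; exists (Num.truncn (1 - fine (nu w (B k)))^-1) => //; exists N => //.
split; last by move=> i /vN vi; rewrite /B /= vi andbT; case/andP: (v01 i w).
rewrite -(fineK Bkfin) lee_fin lerBrDr -lerBrDl invf_ple ?posrE//.
by rewrite ltW// truncnS_gt.
Qed.

(** Where [nu w] is the point mass at 0, almost surely every length, hence every weight, is 0, and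
    the series sums to 0. *)
Lemma proper_nu0_lt1 :
  {ae P, forall w, (\sum_(j <oo) (stick_weight v j w)%:E = 1)%E} ->
  {ae P, forall w, (nu w [set 0%R] < 1)%E}.
Proof.
move=> proper; pose G := [set w | (1 <= nu w [set 0%R])%E].
have m0 : measurable [set 0%R : R] by exact: measurable_set1.
have m1 : measurable [set x : \bar R | (1 <= x)%E].
  by rewrite -set_itvcy; exact: emeasurable_itv.
have mG : measurable G by exact: (measurable_nu_preimage m0 m1).
have v0 i : P.-negligible (G `\` [set w | [set 0%R] (v i w)]).
  have mvi := measurable_v_in i m0.
  apply/negligibleP; first exact: measurableD.
  (* With [m = 1] only [v i] is constrained: the event in [G] where it vanishes has probability
     E[1_G nu{0}] = P(G). *)
  have := @directed_cst [set 0%R] i 1 G m0 (gen_nu_preimage m0 m1).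
  rewrite (_ : [set w | forall j : 'I_(i + 1), _] = [set w | [set 0%R] (v i w)]).
    rewrite (_ : integral _ _ _ = P G) => [PGi|].
      have := measureDI P mG mvi; rewrite [X in (_ + X)%E]PGi.
      have PGfin : P G \is a fin_num by exact: fin_num_measure.
      move=> /(congr1 (fun x => (x - P G)%E)) /=.
      by rewrite [LHS]subee// [RHS]addeK// => <-.
    transitivity (\int[P]_(w in G) 1)%E; last by rewrite integral_cst// mul1e.
    apply: eq_integral => w; rewrite inE => Gw; congr EFin.
    rewrite expr1; suff -> : nu w [set 0%R] = 1%E by [].
    by apply/eqP; rewrite eq_le Gw andbT; exact: probability_le1.
  apply/seteqP; split => w /= H; last first.
    move=> j ij; rewrite (_ : j = i :> nat)//; apply/eqP; rewrite eqn_leq ij andbT.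
    by have := ltn_ord j; rewrite {2}addn1 ltnS.
  by apply: (H (Ordinal (_ : i < i + 1)%N)) => //; rewrite addn1.
apply: negligibleS (negligibleU proper (negligible_bigcup v0)) => w /= /negP.
rewrite -leNgt => Gw; have [[i vi]|vw] := pselect (exists i, v i w <> 0).
  by right; exists i.
left; rewrite eseries0 => [/eqP|j _ _]; first by rewrite eq_sym onee_eq0.
rewrite /stick_weight (_ : v j w = 0) ?mul0r//.
by apply: contrapT => vj; apply: vw; exists j.
Qed.

(** The probability is E[nu(B)^n], which can vanish only if nu(B) = 0 almost surely. *)
Lemma directed_in_gt0 (B : set R) n : measurable B ->
  (0 < \int[P]_w nu w B)%E -> (0 < P [set w | forall i : 'I_n, B (v i w)])%E.
Proof.
move=> mB nuB.
have sT : <<s gen_by_random_measure (fun w => nu w) >> setT.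
  have [s0 sC _] := smallest_sigma_algebra setT
    (gen_by_random_measure (fun w => nu w : set R -> \bar R)).
  by have := sC _ s0; rewrite setD0.
have := directed_cst 0 n mB sT.
rewrite setTI (_ : [set w | _] = [set w | forall i : 'I_n, B (v i w)]); last first.
  by apply/seteqP; split => w /= H i; [exact: H|move=> _; exact: H].
have f0 w : (0 <= (fine (nu w B) ^+ n)%:E)%E.
  by rewrite lee_fin exprn_ge0// fine_ge0.
move=> ->; rewrite lt_neqAle eq_sym integral_ge0// andbT; apply/eqP => int0.
have mf : measurable_fun setT (fun w => (fine (nu w B) ^+ n)%:E).
  by apply/measurable_EFinP/measurable_funX; exact: measurable_fine_nu.
have /(ae_eq_integral_abs P measurableT mf) ae0 :
    (\int[P]_w `|(fine (nu w B) ^+ n)%:E| = 0)%E.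
  by rewrite -[RHS]int0; apply: eq_integral => w _; rewrite gee0_abs.
move: nuB; rewrite (_ : integral _ _ _ = 0%E) ?ltxx//.
transitivity (\int[P]_w (cst 0 w : \bar R))%E; last exact: integral0.
apply: ae_eq_integral => //; first exact: mnu.
apply: negligibleS ae0 => w /= nw fw; apply: nw => _.
have /eqP := fw I; rewrite eqe expf_eq0 => /andP[_ /eqP nuw].
by rewrite -(fineK (nu_fin_num w mB)) nuw.
Qed.

End directed.

(** * The topological support of the process *)

(** Moving the atoms from [z j] to [s j] costs at most [delta], as the weights sum to at most 1;
    replacing the weights by x(1-x)^j costs at most [2 * m%:R * eta * K] in each of [m] terms. *)
Lemma stick_sum_estimate (R : realType) (Omega S : Type) (v : nat -> Omega -> R)
    (w : Omega) (x eta delta K : R) (m : nat) (h : S -> R) (s z : nat -> S) :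
  (forall i w, 0 <= v i w <= 1) -> 0 <= x <= 1 -> 0 <= eta -> 0 <= delta ->
  (forall i, (i < m)%N -> `|v i w - x| <= eta) ->
  (forall y, `|h y| <= K) ->
  (forall j, (j < m)%N -> `|h (z j) - h (s j)| <= delta) ->
  `|\sum_(j < m) stick_weight v j w * h (z j)| <=
    delta + m%:R * (2 * m%:R * eta * K) +
    `|\sum_(j < m) stick_weight (fun _ (_ : unit) => x) j tt * h (s j)|.
Proof.
move=> v01 x01 eta0 delta0 vx hK hzs.
pose a j := stick_weight v j w.
pose b j := stick_weight (fun _ (_ : unit) => x) j tt.
have -> : \sum_(j < m) a j * h (z j) =
    \sum_(j < m) a j * (h (z j) - h (s j)) +
    \sum_(j < m) (a j - b j) * h (s j) + \sum_(j < m) b j * h (s j).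
  by rewrite -!big_split/=; apply: eq_bigr => j _; ring.
rewrite (le_trans (ler_normD _ _))// lerD2r (le_trans (ler_normD _ _))// lerD//.
- rewrite (le_trans (ler_norm_sum _ _ _))//.
  apply: (@le_trans _ _ (\sum_(j < m) a j * delta)).
    apply: ler_sum => j _; rewrite normrM ger0_norm ?stick_weight_ge0//.
    by rewrite ler_wpM2l ?stick_weight_ge0// hzs.
  rewrite -mulr_suml ler_piMl// stick_sum.
  by have := remainder01 v01 m w; lra.
- rewrite (le_trans (ler_norm_sum _ _ _))//.
  apply: (@le_trans _ _ (\sum_(j < m) 2 * m%:R * eta * K)).
    apply: ler_sum => j _; rewrite normrM ler_pM//.
    exact: (@stick_weight_dist _ _ _ v01 (fun=> x)).
  by rewrite sumr_const card_ord -[leLHS]mulr_natl.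
Qed.

(** Each weight is at most [x], and the weights sum to at most 1. *)
Lemma stick_cst_sum_sqr (R : realType) (x : R) m : 0 <= x <= 1 ->
  \sum_(j < m) stick_weight (fun _ (_ : unit) => x) j tt ^+ 2 <= x.
Proof.
move=> x01; have /andP[x0 _] := x01; pose v (_ : nat) (_ : unit) := x.
have v01 i w : 0 <= v i w <= 1 by [].
apply: (@le_trans _ _ (\sum_(j < m) x * stick_weight v j tt)).
  apply: ler_sum => j _; rewrite expr2 ler_wpM2r ?stick_weight_ge0//.
  by rewrite /stick_weight ler_piMr//; case/andP: (remainder01 v01 j tt).
rewrite -mulr_sumr stick_sum ler_piMr//.
by have := remainder01 v01 m tt; lra.
Qed.

Lemma integral_continuous_eq0 (R : realType) (S : ptopologicalType)
    (m : probability (borel S) R) (g : S -> R) :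
  continuous g -> (forall x, 0 <= g x) ->
  (\int[m]_x (g x)%:E = 0)%E <-> m [set x | 0 < g x] = 0%E.
Proof.
move=> cg g0; have mg : measurable_fun setT (EFin \o (g : borel S -> R)).
  by apply/measurable_EFinP; exact: continuous_borel.
have mpos : measurable ([set x | 0 < g x] : set (borel S)).
  apply: open_borel; have /continuousP := cg => /(_ [set y | 0 < y]); apply.
  exact: open_gt.
have -> : (\int[m]_x (g x)%:E = \int[m]_x `|(g x)%:E|)%E.
  by apply: eq_integral => x _; rewrite gee0_abs// lee_fin.
have negE : ~` (fun x => setT x -> (g x)%:E = cst 0%E x) = [set x | 0 < g x].
  apply/seteqP; split => x /= => [gx|gx gx0].
    by rewrite lt0r g0 andbT; apply/eqP => gx0; apply: gx => _; rewrite gx0.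
  by have [gx1] := gx0 I; rewrite gx1 ltxx in gx.
split=> [/(ae_eq_integral_abs m measurableT mg)|m0].
  by rewrite /ae_eq /almost_everywhere/= => H; apply/negligibleP => //; rewrite -negE.
apply/(ae_eq_integral_abs m measurableT mg).
rewrite /ae_eq /almost_everywhere/=; rewrite /negligible.
have /negligibleP := m0 => /(_ mpos); rewrite -negE; exact.
Qed.

Lemma measurable_forall_ord (d : measure_display) (T : measurableType d) (n : nat)
    (A : 'I_n -> set T) :
  (forall i, measurable (A i)) -> measurable [set x | forall i, A i x].
Proof.
move=> mA; rewrite (_ : [set x | _] = \bigcap_(i in setT) A i).
  by apply: fin_bigcap_measurable => //; exact: finite_finset.
by apply/seteqP; split => x /= H i; [move=> _|]; exact: H.
Qed.

Lemma prode_gt0 (R : realDomainType) (n : nat) (x : 'I_n -> \bar R) :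
  (forall i, 0 < x i)%E -> (0 < \prod_(i < n) x i)%E.
Proof.
by move=> x0; elim/big_ind: _ => [|a b|i _]; [exact: lte01|exact: mule_gt0|].
Qed.

(** * Exchangeable stick-breaking processes and the support of their law *)

Section esb.
Context {R : realType} {S : completePseudoMetricType R}.
Context {d : measure_display} {Omega : measurableType d} (P : probability Omega R).
Context (mu0 : probability (borel S) R) (v : nat -> Omega -> R).
Context (xi : nat -> Omega -> borel S) (mu : Omega -> probability (borel S) R).
Hypothesis mv : forall i, measurable_fun setT (v i).
Hypothesis v01 : forall i w, 0 <= v i w <= 1.
Hypothesis mxi : forall j, measurable_fun setT (xi j).
Hypothesis indep :
  forall (n : nat) (A : 'I_n -> set (borel S)) (B : 'I_n -> set R),
     (forall i, measurable (A i)) -> (forall i, measurable (B i)) ->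
     P [set w | (forall i : 'I_n, A i (xi i w)) /\ (forall i : 'I_n, B i (v i w))]
     = ((\prod_(i < n) mu0 (A i)) * P [set w | forall i : 'I_n, B i (v i w)])%E.
Hypothesis muE : forall w (A : set (borel S)), measurable A ->
     mu w A = ((\sum_(j <oo) (stick_weight v j w)%:E * (\1_A (xi j w))%:E)
               + (1 - \sum_(j <oo) (stick_weight v j w)%:E) * mu0 A)%E.

Lemma esb_ge_atoms w (n : nat) (A : set (borel S)) : measurable A ->
  (\sum_(j < n) (stick_weight v j w)%:E * (\1_A (xi j w))%:E <= mu w A)%E.
Proof.
move=> mA; rewrite muE//; apply: (@le_trans _ _
    (\sum_(j <oo) (stick_weight v j w)%:E * (\1_A (xi j w))%:E)%E).
  rewrite -(big_mkord xpredT (fun j =>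
    (stick_weight v j w)%:E * (\1_A (xi j w))%:E)%E).
  by apply: nneseries_lim_ge => k _; rewrite -EFinM lee_fin mulr_ge0 ?stick_weight_ge0.
by rewrite leeDl// mule_ge0// sube_ge0 ?stick_series_le1// orbT.
Qed.

Lemma atoms_avoid_null (U : set (borel S)) : measurable U -> mu0 U = 0%E ->
  P.-negligible [set w | exists j, U (xi j w)].
Proof.
move=> mU U0; apply: (@negligibleS _ _ _ _ (\bigcup_j (xi j @^-1` U))).
  by move=> w [j Uj]; exists j.
apply: negligible_bigcup => j.
have mj : measurable (xi j @^-1` U) by rewrite -[X in measurable X]setTI; exact: mxi.
apply/negligibleP => //.
(* Independence over [j.+1] coordinates, with only the last atom constrained, isolates the law of
   [xi j]. *)
pose A (i : 'I_j.+1) : set (borel S) := if i == ord_max then U else setT.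
have mA i : measurable (A i) by rewrite /A; case: ifP.
have := indep mA (fun=> @measurableT _ _).
have AU : A ord_max = U by rewrite /A eqxx.
rewrite big_ord_recr/= AU U0 mule0 mul0e => <-; congr (P _).
apply/seteqP; split => w /= => [Uj|[/(_ ord_max)]]; last by rewrite AU.
by split => // i; rewrite /A; case: eqP => // ->.
Qed.

(** If an open [U] meeting the support of [pi] were [mu0]-null, almost surely no atom would fall in
    [U], so [mu w U = 0]; a bump function inside [U] then separates [mu w] from [pi]. *)
Lemma law_support_sub (pi : probability (borel S) R) :
  in_law_support P mu pi -> msupp pi `<=` msupp mu0.
Proof.
move=> pi_law x pix U oU Ux; rewrite lt_neqAle measure_ge0 andbT.
apply/eqP => /esym U0.
have mU := open_borel oU.
(* Complete regularity gives [f] equal to 0 at [x] and 1 off [U]; the bump is [1 - f]. *)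
have := @point_uniform_separator R S x (~` U) (open_closedC oU) (fun nU => nU Ux).
move=> /(@uniform_separatorP _ R)[f [cf f01 fx fU]].
pose g y := 1 - f y.
have f01' y : 0 <= f y <= 1 by have := f01 (f y) (ex_intro2 _ _ y I erefl); rewrite /= in_itv.
have cg : continuous g by move=> y; apply: cvgB; [exact: cvg_cst|exact: cf].
have g0 y : 0 <= g y by have := f01' y; rewrite /g; lra.
have g1 y : `|g y| <= 1 by rewrite ger0_norm//; have := f01' y; rewrite /g; lra.
have gU : [set y | 0 < g y] `<=` U.
  move=> y /=; apply: contraPP => nUy; rewrite /g (_ : f y = 1) ?subrr ?ltxx//.
  by apply: fU; exists y.
have ig := bounded_continuous_integrable pi cg g1.
have opos : open [set y | 0 < g y].
  by have /continuousP := cg => /(_ [set y | 0 < y]); apply; exact: open_gt.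
have pi_pos : (0 < pi [set y | (0 < g y)%R])%E.
  by apply: pix => //=; rewrite /g (fx (f x)) ?subr0//; exists x.
have c0 : 0 < fine (\int[pi]_y (g y)%:E)%E.
  rewrite lt_neqAle fine_ge0 ?andbT; last first.
    by apply: integral_ge0 => y _; rewrite lee_fin.
  apply/eqP => c0; have : (\int[pi]_y (g y)%:E = 0)%E.
    by rewrite -[LHS]fineK ?integrable_fin_num// -c0.
  by move/(integral_continuous_eq0 _ cg g0) => pi0; rewrite pi0 ltxx in pi_pos.
(* The radius is the [pi]-integral of [g] itself, so a measure integrating [g] to 0 lies outside the
   neighbourhood. *)
apply: (pi_law 1%N (fun=> g) _ _ c0); first by move=> _; split => //; exists 1.
apply: negligibleS (atoms_avoid_null mU U0) => w /= /(_ ord0).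
apply: contraPP => /forallNP nUw.
have -> : (\int[mu w]_y (g y)%:E = 0)%E.
  apply/integral_continuous_eq0 => //; apply/eqP; rewrite -measure_le0.
  apply: (@le_trans _ _ (mu w U)).
    by apply: le_measure; rewrite ?inE//; exact: open_borel.
  rewrite muE// U0 mule0 adde0 eseries0// => j _ _.
  by rewrite indicE memNset ?mule0//; exact: nUw.
rewrite -(fineK (integrable_fin_num measurableT ig)) sub0e abseN.
by rewrite gee0_abs ?lee_fin ?ltW// ltxx.
Qed.

Hypothesis pS : polish S.

Lemma atoms_lengths_gt0 (m : nat) (s : nat -> S) (V : nat -> set S) (B : set R) :
  (forall j, open (V j)) -> (forall j, V j (s j)) -> (forall j, msupp mu0 (s j)) ->
  measurable B -> (0 < P [set w | forall i : 'I_m, B (v i w)])%E ->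
  (0 < P [set w | (forall i : 'I_m, V i (xi i w)) /\
                  (forall i : 'I_m, B (v i w))])%E.
Proof.
move=> oV Vs s0 mB PB.
rewrite (indep (fun i => open_borel (oV i)) (fun=> mB)) mule_gt0//.
by apply: prode_gt0 => i; exact: s0.
Qed.

(** The mass outside the first [m] atoms is the remaining stick, on which [h] is bounded by [K]. *)
Lemma dist_integral_esb (w : Omega) (m : nat) (h : S -> R) (K : R) :
  continuous h -> (forall x, `|h x| <= K) ->
  (`|\int[mu w]_x (h x)%:E| <=
    (K * \prod_(i < m) (1 - v i w) +
     `|\sum_(j < m) stick_weight v j w * h (xi j w)|)%:E)%E.
Proof.
move=> ch hK.
have := @dist_integral_atoms R _ _ (mu w) m (fun j => stick_weight v j w)
  (fun j => xi j w) h K (fun j => stick_weight_ge0 v01 j w) (esb_ge_atoms w m)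
  (continuous_borel ch) hK.
rewrite stick_sum opprB addrCA subrr addr0 /=.
have ih := bounded_continuous_integrable (mu w) ch hK.
rewrite -(fineK (integrable_fin_num measurableT ih)) /= !lee_fin.
by rewrite !ler_norml; set X := \sum_(j < m) _; have := ler_norm X;
  have := ler_norm (- X); rewrite normrN; lra.
Qed.

(** An event of positive probability, lengths near [x] and atoms near balanced points, is shown to
    lie inside the given weak neighbourhood. *)
Lemma sub_law_support (eps : R) (pi : probability (borel S) R) : 0 < eps ->
  (forall (x : R) (U : set R) m, 0 < x < eps -> open U -> U x ->
    (0 < P [set w | forall i : 'I_m, U (v i w)])%E) ->
  msupp pi `<=` msupp mu0 -> in_law_support P mu pi.
Proof.
move=> eps0 Pv pi_mu0 n f e fcb e0.
have /choice[M fM] i : exists M : R, forall x, `|f i x| <= M.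
  by have [] := fcb i.
pose y i := fine (\int[pi]_x (f i x)%:E)%E.
(* Centring gives [pi]-integral zero, so the integral of [h i] under [mu w] is the quantity to be
   made small. *)
pose h i x := f i x - y i.
pose K := 1 + \sum_i (M i + `|y i|).
have M0 i : 0 <= M i by exact: le_trans (normr_ge0 _) (fM i point).
have K1 : 1 <= K by rewrite lerDl sumr_ge0// => i _; rewrite addr_ge0.
have hK i x : `|h i x| <= K.
  rewrite /K (bigD1 i)//= addrCA (le_trans (ler_normB _ _))// -[leLHS]addr0.
  rewrite lerD ?lerD2r//.
  by rewrite addr_ge0// sumr_ge0// => j _; rewrite addr_ge0.
have ch i : continuous (h i).
  by move=> x; apply: cvgB; [exact: (fcb i).1|exact: cvg_cst].
have intf (m : probability (borel S) R) i : m.-integrable setT (EFin \o (f i : borel S -> R)).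
  exact: bounded_continuous_integrable (fcb i).1 (fM i).
have inth (m : probability (borel S) R) i :
    (\int[m]_x (h i x)%:E = \int[m]_x (f i x)%:E - \int[pi]_x (f i x)%:E)%E.
  rewrite -[X in (_ - X)%E](fineK (integrable_fin_num measurableT (intf pi i))).
  have ic : m.-integrable setT (EFin \o cst (y i)).
    exact: finite_measure_integrable_cst.
  have := integralB_EFin measurableT (intf m i) ic => /= intB.
  under eq_integral do rewrite EFinB.
  have yE : (\int[m]_x (y i)%:E = (y i)%:E)%E.
    have := integral_cst m measurableT (y i)%:E => /= ->.
    by have -> := probability_setT m; rewrite mule1.
  by rewrite intB yE.
have h0 i : (\int[pi]_x (h i x)%:E = 0)%E.
  by rewrite inth subee// (integrable_fin_num measurableT (intf pi i)).
pose D := n%:R * K ^+ 2.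
have D0 : 0 <= D by rewrite mulr_ge0// sqr_ge0.
(* Four errors, each at most [delta], will arise: moving the atoms, balancing, the geometric
   remainder, and perturbing the lengths. *)
pose delta := e / 8.
have delta0 : 0 < delta by rewrite divr_gt0.
(* The squared balancing error is at most [D * x]. Dividing by [D + 1] below covers [D = 0]. *)
have [x [x0 xeps x1 Dx]] : exists x : R, [/\ 0 < x, x < eps, x < 1 & D * x <= delta ^+ 2].
  have d0 : 0 < delta ^+ 2 / (D + 1) by rewrite divr_gt0 ?exprn_gt0// ltr_wpDl.
  exists (Num.min (eps / 2) (Num.min 2^-1 (delta ^+ 2 / (D + 1)))); split.
  - by rewrite !lt_min d0 andbT divr_gt0//= invr_gt0 ltr0n.
  - by rewrite gt_min; apply/orP; left; lra.
  - by rewrite !gt_min; apply/orP; right; apply/orP; left; lra.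
  - apply: (@le_trans _ _ (D * (delta ^+ 2 / (D + 1)))).
      by rewrite ler_wpM2l// !ge_min lexx !orbT.
    rewrite mulrA ler_pdivrMr ?ltr_wpDl// mulrDr mulr1 mulrC.
    by rewrite lerDl sqr_ge0.
have x01 : 0 <= x <= 1 by rewrite !ltW.
have w0_ge0 j : 0 <= stick_weight (fun _ (_ : unit) => x) j tt.
  by apply: stick_weight_ge0 => _ _.
have [s sD sbal] := @greedy_balancing R S (msupp pi) n h K _ w0_ge0 hK
  (fun c => msupp_lincomb_le0 c pS ch hK h0).
have [m xm] := @exists_exp_lt R (1 - x) (delta / K) ltac:(lra)
  ltac:(rewrite divr_gt0//; lra).
pose q : R := m%:R + 1.
(* As [q] is m + 1, [delta] bounds both perturbation costs together, 2 m^2 eta K for the weights and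
   m eta K for the remainder; [q] is positive even when [m] is 0. *)
pose eta := delta / (2 * K * q ^+ 2).
have m0 : 0 <= m%:R :> R by [].
have q0 : 0 < q by rewrite ltr_wpDl.
have K0 : 0 < K by lra.
have eta0 : 0 < eta by rewrite divr_gt0// !mulr_gt0// exprn_gt0.
have etaE : 2 * K * q ^+ 2 * eta = delta.
  by rewrite /eta mulrC divfK// gt_eqF// !mulr_gt0.
pose V j := interior [set z : S | forall i, `|h i z - h i (s j)| < delta].
have Vs j : V j (s j).
  apply: filter_forall => i; have /cvgr_dist_lt/(_ _ delta0) := ch i (s j).
  by apply: filterS => z; rewrite distrC.
pose U := [set z : R | x - eta < z] `&` [set z : R | z < x + eta].
have oU : open U by apply: openI; [exact: open_gt|exact: open_lt].
have Ux : U x by rewrite /U /=; split; lra.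
have PU : (0 < P [set w | forall i : 'I_m, U (v i w)])%E.
  by apply: (Pv x) => //; rewrite x0.
have Ppos := @atoms_lengths_gt0 m s V U (fun=> open_interior _) Vs
  (fun j => pi_mu0 _ (sD j)) (open_measurable oU) PU.
move=> negl; move: Ppos; apply/negP; rewrite -leNgt measure_le0; apply/eqP.
apply/negligibleP.
  rewrite [X in measurable X](_ : _ = [set w | forall i : 'I_m, V i (xi i w)] `&`
      [set w | forall i : 'I_m, U (v i w)])//.
  apply: measurableI; apply: measurable_forall_ord => i.
    rewrite -[X in measurable X]setTI; apply: mxi => //.
    by apply: open_borel; exact: open_interior.
  by rewrite -[X in measurable X]setTI; apply: mv => //; exact: open_measurable.
(* It remains to prove, deterministically, that the event is contained in the weak neighbourhood. *)
apply: negligibleS negl => w [Vw Uw] i; rewrite -inth.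
apply: le_lt_trans (dist_integral_esb w m (ch i) (hK i)) _; rewrite lte_fin.
have vx j : (j < m)%N -> `|v j w - x| <= eta.
  by move=> jm; have [] := Uw (Ordinal jm); rewrite /= ler_norml; lra.
have hV j : (j < m)%N -> `|h i (xi j w) - h i (s j)| <= delta.
  by move=> jm; rewrite ltW//; apply: (interior_subset (Vw (Ordinal jm))).
have sum_le := stick_sum_estimate v01 x01 (ltW eta0) (ltW delta0) vx (hK i) hV.
have rem_le : \prod_(j < m) (1 - v j w) <= (1 - x) ^+ m + m%:R * eta.
  have dv j : (j < m)%N -> `|(1 - v j w) - (1 - x)| <= eta.
    by move=> /vx; rewrite !ler_norml; lra.
  have ox01 : 0 <= 1 - x <= 1 by lra.
  have := @dist_prod_le R (fun j => 1 - v j w) (fun=> 1 - x) eta m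
    (fun j => onem_v01 v01 j w) (fun=> ox01) dv.
  by rewrite prodr_const card_ord ler_norml; lra.
(* One coordinate is bounded by the whole squared norm, which greedy balancing keeps below
   [D * x]. *)
have bal_le : `|\sum_(j < m) stick_weight (fun _ (_ : unit) => x) j tt * h i (s j)|
    <= delta.
  rewrite -ler_sqr ?nnegrE ?(ltW delta0)// real_normK ?num_real//.
  apply: (le_trans _ Dx); apply: (le_trans (le_trans _ (sbal m)) _); last first.
    by rewrite ler_wpM2l// stick_cst_sum_sqr.
  by rewrite (bigD1 i)//= lerDl sumr_ge0// => j _; exact: sqr_ge0.
have Kx : K * (1 - x) ^+ m < delta by rewrite mulrC -ltr_pdivlMr.
have Krem := ler_wpM2l (ltW K0) rem_le.
pose p := K * eta.
have p0 : 0 <= p by rewrite mulr_ge0// ltW.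
have pm : 0 <= p * m%:R by rewrite mulr_ge0.
have pmm : 0 <= p * m%:R * m%:R by rewrite mulr_ge0.
have deltaE : delta = 2 * (p * m%:R * m%:R) + 4 * (p * m%:R) + 2 * p.
  by rewrite -etaE /p /q; ring.
have eE : e = 8 * delta by rewrite /delta; field.
move: sum_le Krem.
rewrite (_ : K * ((1 - x) ^+ m + m%:R * eta) = K * (1 - x) ^+ m + p * m%:R);
  last by rewrite /p; ring.
rewrite (_ : m%:R * (2 * m%:R * eta * K) = 2 * (p * m%:R * m%:R));
  last by rewrite /p; ring.
by lra.
Qed.

End esb.

(** * Full support and properness *)

Unset Implicit Arguments.

Theorem theorem1 (R : realType) (S : completePseudoMetricType R)
  (d : measure_display) (Omega : measurableType d) (P : probability Omega R)
  (mu0 : probability (borel S) R)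
  (v : nat -> Omega -> R) (xi : nat -> Omega -> borel S)
  (nu : Omega -> probability R R)
  (mu : Omega -> probability (borel S) R) :
  polish S ->
  (* mu0 is diffuse *)
  (forall x : borel S, mu0 [set x] = 0%E) ->
  (* the lengths are [0,1]-valued random variables *)
  (forall i, measurable_fun setT (v i)) ->
  (forall i w, 0 <= v i w <= 1) ->
  (* nu is a random probability measure on [0,1] directing (v_i) *)
  (forall w, nu w [set x : R | 0 <= x <= 1] = 1%E) ->
  (forall B : set R, measurable B -> measurable_fun setT (fun w => nu w B)) ->
  directed_by P v (fun w => nu w) ->
  (* the atoms are i.i.d. mu0, independent of the lengths *)
  (forall j, measurable_fun setT (xi j)) ->
  (forall (n : nat) (A : 'I_n -> set (borel S)) (B : 'I_n -> set R),
     (forall i, measurable (A i)) -> (forall i, measurable (B i)) ->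
     P [set w | (forall i : 'I_n, A i (xi i w)) /\ (forall i : 'I_n, B i (v i w))]
     = ((\prod_(i < n) mu0 (A i)) * P [set w | forall i : 'I_n, B i (v i w)])%E) ->
  (* mu is the ESB random probability measure *)
  (forall w (A : set (borel S)), measurable A ->
     mu w A = ((\sum_(j <oo) (stick_weight v j w)%:E * (\1_A (xi j w))%:E)
               + (1 - \sum_(j <oo) (stick_weight v j w)%:E) * mu0 A)%E) ->
  ((exists eps : R, 0 < eps /\
      [set x : R | 0 < x < eps] `<=` msupp (fun B : set R => (\int[P]_w nu w B)%E)) ->
    forall pi : probability (borel S) R,
      in_law_support P mu pi <-> msupp pi `<=` msupp mu0)
  /\
  ({ae P, forall w, (\sum_(j <oo) (stick_weight v j w)%:E = 1)%E} <->
   {ae P, forall w, (nu w [set 0%R] < 1)%E}).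
Proof.
move=> pS _ mv v01 _ mnu vnu mxi indep muE; split.
  move=> [eps [eps0 supp_nu0]] pi; split; first exact: (law_support_sub mxi indep muE).
  (* The support condition on E[nu] enters as the positive probability that the first [m] lengths
     all lie in [U]. *)
  apply: (sub_law_support mv v01 mxi indep muE pS eps0) => x U m xeps oU Ux.
  apply: (directed_in_gt0 mnu vnu); first exact: open_measurable.
  exact: (supp_nu0 x xeps U oU Ux).
split; first exact: (proper_nu0_lt1 mv mnu vnu).
move=> /(ae_infinitely_often_large mv v01 mnu vnu).
apply: negligibleS => w /= nproper [delta delta0 large]; apply: nproper.
exact: stick_series_eq1 large.
Qed.
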